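(* Let $R$ be a commutative ring with nonzero identity, $f:M\to M'$ an epimorphism of $R$-modules, and $\phi:S(M)\to S(M)\cup\{\emptyset\}$ and $\phi':S(M')\to S(M')\cup\{\emptyset\}$ two functions. Then: (1) If $N'$ is a $\phi'$-classical 1-absorbing prime submodule of $M'$ and $\phi(f^{-1}(N'))=f^{-1}(\phi'(N'))$, then $f^{-1}(N')$ is a $\phi$-classical 1-absorbing prime submodule of $M$. (2) If $N$ is a $\phi$-classical 1-absorbing prime submodule of $M$ containing $\operatorname{Ker}(f)$ and $\phi'(f(N))=f(\phi(N))$, then $f(N)$ is a $\phi'$-classical 1-absorbing prime submodule of $M'$.
   Context: All modules are unitary. $S(M)$ is the set of all submodules of $M$. Standing assumption: $\phi(N)\subseteq N$ for every submodule $N$ (and likewise for $\phi'$). A proper submodule $N$ of $M$ is $\phi$-classical 1-absorbing prime if whenever $a,b,c\in R$ are nonunits and $m\in M$ with $abcm\in N\setminus\phi(N)$, then $abm\in N$ or $cm\in N$. *)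

(* Defs.v *)
From HB Require Import structures.
From mathcomp Require Import all_boot all_order all_algebra.
From mathcomp Require Import boolp classical_sets functions.

Set Implicit Arguments.
Unset Strict Implicit.
Unset Printing Implicit Defensive.

Import GRing.Theory.
Local Open Scope classical_set_scope.
Local Open Scope ring_scope.

(* Invertibility is a proposition here, so that R can be an arbitrary
   comNzRingType rather than one equipped with a boolean test for units. *)
Definition nonunit (R : comNzRingType) (a : R) : Prop :=
  ~ exists b : R, a * b = 1.

Section Submodules.
Variables (R : comNzRingType) (M : lmodType R).

(* S(M), as a classical set of subsets of M; used as a type it denotes the
   subtype of the subsets of M that are submodules, and \val forgets the proof.
   In the same way, the set S(M) `|` [set set0] is used as a codomain below. *)
Definition submodules : set (set M) :=
  [set N | submod_closed [pred x | x \in N]].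

Definition phi_classical_1abs_prime
    (phi : submodules -> submodules `|` [set set0]) (N : submodules) : Prop :=
  \val N <> [set: M] /\
  forall (a b c : R) (m : M),
    nonunit a -> nonunit b -> nonunit c ->
    (\val N `\` \val (phi N)) ((a * b * c) *: m) ->
    \val N ((a * b) *: m) \/ \val N (c *: m).

End Submodules.

Arguments submodules {R} M.

Section Transport.
Variables (R : comNzRingType) (M M' : lmodType R) (f : {linear M -> M'}).

Lemma preimage_submodule (N' : submodules M') :
  f @^-1` \val N' \in submodules M.
Proof.
have := set_valP N'; rewrite /= => -[N'0 N'lin].
apply/mem_set; split=> [|a u v]; rewrite !inE /=.
  by rewrite linear0; move: N'0; rewrite !inE.
move=> N'u N'v; rewrite linearP.
have := N'lin a (f u) (f v); rewrite !inE /=; exact.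
Qed.

Lemma image_submodule (N : submodules M) :
  f @` \val N \in submodules M'.
Proof.
have := set_valP N; rewrite /= => -[N0 Nlin].
apply/mem_set; split=> [|a u v]; rewrite !inE /=.
  by exists 0; rewrite ?linear0 //; move: N0; rewrite !inE.
move=> [x Nx <-] [y Ny <-]; exists (a *: x + y); last by rewrite linearP.
have := Nlin a x y; rewrite !inE /=; exact.
Qed.

Definition preim_submod (N' : submodules M') : submodules M :=
  SigSub (preimage_submodule N').

Definition im_submod (N : submodules M) : submodules M' :=
  SigSub (image_submodule N).

End Transport.

(* Main.v *)
Require Import Defs.
From HB Require Import structures.
From mathcomp Require Import all_boot all_order all_algebra.
From mathcomp Require Import boolp classical_sets functions.
Import GRing.Theory.
Local Open Scope classical_set_scope.
Local Open Scope ring_scope.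

(** Since [f] commutes with scalars, the prime condition transfers with the same [a], [b], [c], the
    vector [m] being traded for [f m]. For preimages this is immediate, membership in [f @^-1] being
    membership of [f m]. For images, surjectivity writes each vector as [f m], and
    [mem_image_submodule] descends from [f N] to [N]: two points with equal image differ by an
    element of the kernel, which lies in [N]. *)

Lemma mem_image_submodule {R : comNzRingType} {M M' : lmodType R}
    {f : {linear M -> M'}} {N : submodules M} {x : M} :
  f @^-1` [set 0] `<=` \val N -> (f @` \val N) (f x) -> \val N x.
Proof.
move=> kerN [n Nn fnx].
have := set_valP N; rewrite /= => -[_ Nlin].
(* Closure under [a *: u + v] at scalar 1 recovers [x] as [(x - n) + n]. *)
have := Nlin 1 (x - n) n; rewrite !inE scale1r subrK; apply=> //.
by apply: kerN; rewrite /= linearB fnx subrr.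
Qed.

Theorem proposition3 (R : comNzRingType) (M M' : lmodType R)
    (f : {linear M -> M'}) (f_epi : set_surj [set: M] [set: M'] f)
    (phi : submodules M -> submodules M `|` [set set0])
    (phi' : submodules M' -> submodules M' `|` [set set0])
    (phi_sub : forall N : submodules M, \val (phi N) `<=` \val N)
    (phi'_sub : forall N' : submodules M', \val (phi' N') `<=` \val N') :
  (forall N' : submodules M',
      phi_classical_1abs_prime phi' N' ->
      \val (phi (preim_submod f N')) = f @^-1` \val (phi' N') ->
      phi_classical_1abs_prime phi (preim_submod f N')) /\
  (forall N : submodules M,
      phi_classical_1abs_prime phi N ->
      f @^-1` [set 0] `<=` \val N ->
      \val (phi' (im_submod f N)) = f @` \val (phi N) ->
      phi_classical_1abs_prime phi' (im_submod f N)).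
Proof.
have f_surj y : exists x, f x = y by have [x _ fx] := f_epi y I; exists x.
split=> [N' [N'T N'prime] phiE|N [NT Nprime] kerN phiE].
  split=> [preT|a b c m ua ub uc].
    (* Properness: if the preimage were all of [M], [N'] would contain every [f x], hence all of
       [M']. *)
    apply: N'T; apply/seteqP; split=> // y _; have [x <-] := f_surj y.
    by rewrite -[\val N' _]/((f @^-1` \val N') x) [f @^-1` _]preT.
  rewrite phiE => -[/= N'm phi'm].
  rewrite !linearZ /=; rewrite !linearZ /= in N'm phi'm.
  exact: N'prime ua ub uc (conj N'm phi'm).
split=> [imT|a b c m' ua ub uc].
  apply: NT; apply/seteqP; split=> // x _.
  by apply: (mem_image_submodule kerN); rewrite [f @` _]imT.
have [m <-] := f_surj m'; rewrite phiE -!linearZ => -[/= fNm phi'm].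
have Nm : \val N ((a * b * c) *: m) by exact: mem_image_submodule fNm.
(* [phi N] may fail to contain the kernel, so membership in its image cannot be lifted;
   non-membership can, because [f] sends [phi N] into that image. *)
have phim : ~ \val (phi N) ((a * b * c) *: m).
  by move=> phim; apply: phi'm; exists ((a * b * c) *: m).
by have [Nabm|Ncm] := Nprime a b c m ua ub uc (conj Nm phim);
  [left; exists ((a * b) *: m)|right; exists (c *: m)].
Qed.
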